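(* Let $\mathbb E=\{\mathbb D_1=\mathbb D_2\}_{\alpha_1,\dots,\alpha_n,\delta_1,\dots,\delta_m}$ be a family of diagrammatic equations in ZX, ZH or ZW, parameterised by phase variables $\alpha_j$ and !-boxes $\delta_k$, where the !-box $\delta_1$ is separated from all other !-boxes and is nested in no other !-box. Let $n_1$ and $n_2$ be the sizes of the join of $\delta_1$ in $\mathbb D_1$ and in $\mathbb D_2$ respectively, and let $$N:=\dim\left(\mathbb H^{\otimes n_1}\oplus\mathbb H^{\otimes n_2}\right)=2^{n_1}+2^{n_2},$$ the sum of the dimensions of the joins. Then $\mathbb E$ is verified by the finite family $\{\mathbb E|_{\delta_1=0},\dots,\mathbb E|_{\delta_1=N}\}$: if $\mathbb D_1$ and $\mathbb D_2$ have equal interpretations whenever $\delta_1$ is instantiated at $d_1\le N$ (for all values of the other parameters), then they have equal interpretations for all values of all parameters.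
   Context: Let $K$ be a field ($K=\mathbb C$ for ZX) and $\mathbb H=K^2$. Diagrams $n\to m$ are interpreted as linear maps $\mathbb H^{\otimes n}\to\mathbb H^{\otimes m}$ (wires, swaps, cups $(1\,0\,0\,1)^T$, caps $(1\,0\,0\,1)$ as usual). Generators: ZX — Z spiders $|0\cdots0\rangle\langle0\cdots0|+e^{i\alpha}|1\cdots1\rangle\langle1\cdots1|$, X spiders (same in the basis $|\pm\rangle=\frac1{\sqrt2}(|0\rangle\pm|1\rangle)$), Hadamard gate. ZW over $K$ — white spiders $|0\cdots0\rangle\langle0\cdots0|+r|1\cdots1\rangle\langle1\cdots1|$, black spiders $0\to n$ $\sum_{k}|0^{k-1}1\,0^{n-k}\rangle$ (any legs may be bent to inputs), crossing $\begin{pmatrix}1&0&0&0\\0&0&1&0\\0&1&0&0\\0&0&0&-1\end{pmatrix}$. ZH over $K$ ($\tfrac12\in K$) — white spiders $|0\cdots0\rangle\langle0\cdots0|+|1\cdots1\rangle\langle1\cdots1|$, H-boxes $\sum r^{i_1\cdots i_mj_1\cdots j_n}|j_1\cdots j_n\rangle\langle i_1\cdots i_m|$ (sum over bits). A !-box marks a set of nodes (possibly including boundary inputs/outputs) of a diagram; instantiating it at $d\in\mathbb N$ replaces the marked part by $d$ copies, each connected to the rest of the diagram as the original was (so unmarked nodes joined to it must be spiders of arbitrary arity). Phase variable names are copied unchanged. A !-box in an equation occurs on both sides and is instantiated at the same number on both sides; phase variables are likewise instantiated simultaneously on both sides. !-boxes may be nested (one contained in another). Two !-boxes are separated if either one is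 nested in the other, or no edge joins a node in one to a node in the other. The join of a !-box in a diagram is the collection of wires from a node inside it to a node outside it; its size is the number of these wires in the (uninstantiated) diagram, and its dimension is $(\dim\mathbb H)^{\text{size}}$. An equation with parameters is sound if for all values of the parameters both sides have equal interpretations; a set of equations verifies $\mathbb E$ if soundness of all of them implies soundness of $\mathbb E$. *)

(* Defs.v *)
From HB Require Import structures.
From mathcomp Require Import all_boot all_order all_algebra.
From mathcomp Require Import complex.
From mathcomp Require Import reals trigo.

Set Implicit Arguments.
Unset Strict Implicit.
Unset Printing Implicit Defensive.

Import Order.TTheory GRing.Theory Num.Theory.

Local Open Scope ring_scope.
Local Open Scope complex_scope.

(** * The three calculi *)

(* The complex numbers are R[i], for R any model of the real numbers. *)
Inductive calculus : Type :=
| ZX (R : realType)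
| ZH (K : fieldType) (half : 2%:R != 0 :> K)
| ZW (K : fieldType).

Definition scalars (C : calculus) : fieldType :=
  match C with
  | ZX R => R[i]
  | ZH K _ => K
  | ZW K => K
  end.

(* A ZX phase is an angle; a phase of ZH or ZW is a scalar. *)
Definition phase (C : calculus) : Type :=
  match C with
  | ZX R => R
  | ZH K _ => K
  | ZW K => K
  end.

Inductive zx_gen := ZX_Z | ZX_X | ZX_Hadamard.
Inductive zh_gen := ZH_white | ZH_box.
Inductive zw_gen := ZW_white | ZW_black | ZW_crossing.

Definition gen (C : calculus) : Type :=
  match C with
  | ZX _ => zx_gen
  | ZH _ _ => zh_gen
  | ZW _ => zw_gen
  end.

(* A Circle is a closed wire that meets no generator (a cup followed by a cap):
   in a graph it has to be recorded as a node, of arity 0. *)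
Inductive label (C : calculus) := Circle | Gen of gen C.
Arguments Circle {C}.

(* None is the arity of the nodes that may have any number of legs. *)
Definition gen_arity (C : calculus) : gen C -> option nat :=
  match C return gen C -> option nat with
  | ZX _ => fun g => if g is ZX_Hadamard then Some 2%N else None
  | ZH _ _ => fun=> None
  | ZW _ => fun g => if g is ZW_crossing then Some 4%N else None
  end.

Definition arity (C : calculus) (a : label C) : option nat :=
  if a is Gen g then gen_arity g else Some 0%N.

(* Each generator is given by its matrix coefficients, as a function of the list
   s of the bits on all its legs, inputs first and then outputs.  As cups and
   caps are (1 0 0 1), bending a leg does not change the coefficients. *)

Definition expi (R : realType) (a : R) : R[i] := cos a +i* sin a.

Definition inv_sqrt2 (R : realType) : R[i] := ((Num.sqrt 2%:R)^-1)%:C.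

(* |0..0><0..0| + r |1..1><1..1|; with no legs at all this is 1 + r. *)
Definition spider_coef (K : fieldType) (r : K) (s : seq bool) : K :=
  (all negb s)%:R + r * (all id s)%:R.

(* <b|+> = 1/sqrt 2 and <b|-> = (-1)^b / sqrt 2 are real, hence also the
   coefficients of the bras <+| and <-|. *)
Definition zx_coef (R : realType) (g : zx_gen) (a : R) (s : seq bool) : R[i] :=
  match g with
  | ZX_Z => spider_coef (expi a) s
  | ZX_X => \prod_(b <- s) inv_sqrt2 R
            + expi a * \prod_(b <- s) ((-1) ^+ b * inv_sqrt2 R)
  | ZX_Hadamard =>
      if s is [:: i; j] then (-1) ^+ (i && j) * inv_sqrt2 R else 0
  end.

Definition zh_coef (K : fieldType) (g : zh_gen) (r : K) (s : seq bool) : K :=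
  match g with
  | ZH_white => spider_coef 1 s
  | ZH_box => r ^+ (\prod_(b <- s) nat_of_bool b)%N
  end.

(* The crossing sends |i1 i2> to (-1)^(i1 i2) |i2 i1>. *)
Definition zw_coef (K : fieldType) (g : zw_gen) (r : K) (s : seq bool) : K :=
  match g with
  | ZW_white => spider_coef r s
  | ZW_black => (count id s == 1%N)%:R
  | ZW_crossing =>
      if s is [:: i1; i2; j1; j2]
      then ((j1 == i2) && (j2 == i1))%:R * (-1) ^+ (i1 && i2) else 0
  end.

Definition gen_coef (C : calculus) :
    gen C -> phase C -> seq bool -> scalars C :=
  match C return gen C -> phase C -> seq bool -> scalars C with
  | ZX R => @zx_coef R
  | ZH K _ => @zh_coef K
  | ZW K => @zw_coef K
  end.

(* The value of a Circle is dim H. *)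
Definition coef (C : calculus) (a : label C) (p : phase C) (s : seq bool) :
    scalars C :=
  if a is Gen g then gen_coef g p s else 2%:R.

(** * Diagrams *)

(* Diagrams with set of inputs I and set of outputs O, as open graphs.  A wire e
   is an edge with the two ends (e, false) and (e, true), each attached to a
   node, an input (inr (inl i)) or an output (inr (inr o)).  The natural number
   ports orders the ends attached to the same node; it is only relevant at nodes
   of fixed arity.  Swaps, cups and caps are implicit in the graph.  The phase
   is ignored by the generators that have none. *)
Record diagram (C : calculus) (P : Type) (I O : finType) := Diagram {
  node : finType;
  wire : finType;
  node_label : node -> label C;
  node_phase : node -> P;
  endpoint : wire * bool -> node + (I + O);
  port : wire * bool -> nat
}.

Section Diagrams.
Variables (C : calculus) (P : Type) (I O : finType) (D : diagram C P I O).

(* The wire ends attached to a node, by increasing port. *)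
Definition legs (v : node D) : seq (wire D * bool) :=
  sort (relpre (@port _ _ _ _ D) leq)
       [seq l <- enum {: wire D * bool} | endpoint l == inl v].

(* A node that can be attached to arbitrarily many wires; inputs and outputs
   are attached to one. *)
Definition is_spider (u : node D + (I + O)) : bool :=
  if u is inl v then arity (node_label v) == None else false.

Definition well_formed : Prop :=
  (forall b : I + O, #|[set l | endpoint l == inr b :> node D + (I + O)]| = 1%N)
  /\
  (forall (v : node D) (k : nat), arity (node_label v) = Some k ->
     [seq port l | l <- legs v] = iota 0 k).

End Diagrams.

(* H^{(x) I} has the basis of bit assignments {ffun I -> bool}, so a linear map
   H^{(x) I} -> H^{(x) O} is a matrix whose rows and columns are numbered by
   the bit assignments to O and to I. *)
Section Interpretation.
Variables (C : calculus) (I O : finType) (D : diagram C (phase C) I O).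

Definition agrees (w : {ffun wire D -> bool})
    (x : {ffun I -> bool}) (y : {ffun O -> bool}) : bool :=
  [forall l : wire D * bool,
     match endpoint l with
     | inl _ => true
     | inr (inl i) => w l.1 == x i
     | inr (inr o) => w l.1 == y o
     end].

(* The coefficient <y| D |x>: composing the matrices of the nodes along the
   wires amounts to summing over the bits carried by all the wires. *)
Definition amplitude (y : {ffun O -> bool}) (x : {ffun I -> bool}) : scalars C :=
  \sum_(w : {ffun wire D -> bool} | agrees w x y)
    \prod_(v : node D)
      coef (node_label v) (node_phase v) [seq w l.1 | l <- legs v].

Definition interp :
    'M[scalars C]_(#|{ffun O -> bool}|, #|{ffun I -> bool}|) :=
  \matrix_(j, i) amplitude (enum_val j) (enum_val i).

End Interpretation.

(** * Diagrams with phase variables and !-boxes *)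

(* The !-boxes are named by 'I_m.  The two sides of an equation have the same
   inputs and outputs, each lying in the same !-boxes on both sides. *)
Record interface (m : nat) := Interface {
  ins : nat;
  outs : nat;
  in_box : 'I_ins -> {set 'I_m};
  out_box : 'I_outs -> {set 'I_m}
}.

(* Phases are functions of the n phase variables.  A !-box k marks the nodes v
   with k \in node_box v and the inputs and outputs prescribed by F;
   [nested j k] means that j is nested in k. *)
Record pattern (C : calculus) (n m : nat) (F : interface m) := Pattern {
  skel :> diagram C (('I_n -> phase C) -> phase C) 'I_(ins F) 'I_(outs F);
  node_box : node skel -> {set 'I_m};
  nested : rel 'I_m
}.
Arguments node_box {C n m F}.
Arguments nested {C n m F}.

Section Patterns.
Variables (C : calculus) (n m : nat) (F : interface m) (D : pattern C n F).

Definition vertex := (node D + ('I_(ins F) + 'I_(outs F)))%type.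

(* The !-boxes that mark a node, an input or an output. *)
Definition vertex_box (u : vertex) : {set 'I_m} :=
  match u with
  | inl v => node_box D v
  | inr (inl i) => in_box i
  | inr (inr o) => out_box o
  end.

Definition wire_box (e : wire D) : {set 'I_m} :=
  vertex_box (endpoint (e, false)) :|: vertex_box (endpoint (e, true)).

(* An unmarked node joined to a marked one is a spider. *)
Definition joins_spiders : Prop :=
  forall (e : wire D) (s : bool) (k : 'I_m),
    k \notin vertex_box (endpoint (e, s)) ->
    k \in vertex_box (endpoint (e, ~~ s)) ->
    is_spider (endpoint (e, s)).

(* Nesting is recorded explicitly, as the marked sets do not determine it when
   they are empty or equal. *)
Definition well_nested : Prop :=
  [/\ irreflexive (nested D), transitive (nested D) &
      forall (j k : 'I_m) (u : vertex),
        nested D j k -> j \in vertex_box u -> k \in vertex_box u].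

Definition valid_pattern : Prop :=
  [/\ well_formed D, joins_spiders & well_nested].

Definition separated (j k : 'I_m) : Prop :=
  [\/ nested D j k, nested D k j |
      forall (e : wire D) (s : bool),
        ~~ ((j \in vertex_box (endpoint (e, s))) &&
            (k \in vertex_box (endpoint (e, ~~ s))))].

Definition join (k : 'I_m) : {set wire D} :=
  [set e | (k \in vertex_box (endpoint (e, false)))
           (+) (k \in vertex_box (endpoint (e, true)))].

Definition join_size (k : 'I_m) : nat := #|join k|.

(* dim H = 2 *)
Definition join_dim (k : 'I_m) : nat := (2 ^ join_size k)%N.

End Patterns.

(** * Instantiation *)

Section Copies.
Variables (m : nat) (d : 'I_m -> nat).

(* A copy of an item lying in the set B of !-boxes is determined by a copy
   number c k < d k for each k in B; the other entries of c are set to 0. *)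
Definition copy_index := {ffun 'I_m -> 'I_(\max_(k < m) d k).+1}.

Definition copy_of (B : {set 'I_m}) (c : copy_index) : bool :=
  [forall k, c k < (if k \in B then d k else 1)]%N.

Definition copies (T : finType) (box : T -> {set 'I_m}) : finType :=
  {p : T * copy_index | copy_of (box p.1) p.2}.

Definition restrict_index (B : {set 'I_m}) (c : copy_index) : copy_index :=
  [ffun k => if k \in B then c k else ord0].

Lemma restrict_copy_of (A B : {set 'I_m}) (c : copy_index) :
  A \subset B -> copy_of B c -> copy_of A (restrict_index A c).
Proof.
move=> /subsetP sAB /forallP cB; apply/forallP => k; rewrite ffunE.
by case: ifP => // kA; move: (cB k); rewrite (sAB _ kA).
Qed.

End Copies.

Section Instance.
Variables (C : calculus) (n m : nat) (F : interface m) (D : pattern C n F).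
Variables (alpha : 'I_n -> phase C) (d : 'I_m -> nat).

Definition inst_in : finType := copies d (@in_box m F).
Definition inst_out : finType := copies d (@out_box m F).
Definition inst_node : finType := copies d (node_box D).
Definition inst_wire : finType := copies d (@wire_box C n m F D).

Definition copy_vertex (u : vertex D) (c : copy_index d) :
    copy_of (vertex_box u) c -> inst_node + (inst_in + inst_out) :=
  match u return copy_of (vertex_box u) c -> _ with
  | inl v => fun h => inl (exist _ (v, c) h)
  | inr (inl i) => fun h => inr (inl (exist _ (i, c) h))
  | inr (inr o) => fun h => inr (inr (exist _ (o, c) h))
  end.

Lemma end_sub_wire (e : wire D) (s : bool) :
  vertex_box (endpoint (e, s)) \subset wire_box e.
Proof. by case: s; [apply: subsetUr | apply: subsetUl]. Qed.

(* The copy number c of a wire joins the copies of its two endpoints whose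
   numbers agree with c. *)
Definition inst_endpoint (l : inst_wire * bool) :
    inst_node + (inst_in + inst_out) :=
  copy_vertex (restrict_copy_of (end_sub_wire (sval l.1).1 l.2) (svalP l.1)).

Definition instantiate : diagram C (phase C) inst_in inst_out :=
  @Diagram C (phase C) inst_in inst_out inst_node inst_wire
    (fun v => node_label (sval v).1)
    (fun v => node_phase (sval v).1 alpha)
    inst_endpoint
    (fun l => port ((sval l.1).1, l.2)).

End Instance.

(** * Families of equations *)

Record equation (C : calculus) (n m : nat) := Equation {
  iface : interface m;
  lhs : pattern C n iface;
  rhs : pattern C n iface;
  lhs_valid : valid_pattern lhs;
  rhs_valid : valid_pattern rhs
}.

Section Soundness.
Variables (C : calculus) (n m : nat) (E : equation C n m).

Definition holds (alpha : 'I_n -> phase C) (d : 'I_m -> nat) : Prop :=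
  interp (instantiate (lhs E) alpha d) = interp (instantiate (rhs E) alpha d).

Definition sound : Prop := forall alpha d, holds alpha d.

(* Soundness of the family obtained by instantiating the !-box k at c. *)
Definition sound_at (k : 'I_m) (c : nat) : Prop :=
  forall alpha d, d k = c -> holds alpha d.

Definition outer_separated (k : 'I_m) : Prop :=
  forall j : 'I_m, j != k ->
    [/\ separated (lhs E) k j, separated (rhs E) k j,
        ~~ nested (lhs E) k j & ~~ nested (rhs E) k j].

End Soundness.

(* Main.v *)
Require Import Defs.
From mathcomp Require Import all_boot all_order all_algebra.
From mathcomp Require Import complex reals ring.

Set Implicit Arguments.
Unset Strict Implicit.
Unset Printing Implicit Defensive.

Import Order.TTheory GRing.Theory Num.Theory.

Local Open Scope ring_scope.

(* Cut the instance with d copies of delta1 along the join.  An unmarked spider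
   on the join lies in no !-box, so it is not copied, and its coefficients
   depend on a bunch of legs only through a vector of K^2, whatever the number
   of legs.  For fixed bits on the inputs and outputs, each copy of delta1 thus
   acts as a matrix A_i on a space of dimension at most 2^(size of the join),
   and the interpretation is R A_1 ... A_d c, the value of a weighted automaton
   on the word 1 ... d; subwords are values of instances with fewer copies.
   The two sides give automata of total dimension at most N.  On a word longer
   than N, the vectors A_(i+1) ... A_d c of the suffixes are linearly dependent,
   so that the difference of the two sides is a combination of differences on
   proper subwords, which vanish by induction. *)

(** * Weighted automata *)

Section Automaton.
Variables (K : fieldType) (Q : finType) (T : eqType).
Variables (R : Q -> K) (A : T -> Q -> Q -> K) (Z : seq T -> Q -> K).
Hypothesis Z_cons : forall a u q, Z (a :: u) q = \sum_q' A a q q' * Z u q'.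

(** Reading the prefix [p] is a linear map, so it preserves linear relations between the vectors of
    suffixes. *)
Lemma run_cat_linear (k : nat) (c : 'I_k -> K) (s : 'I_k -> seq T) p t q :
  (forall q, Z t q = \sum_i c i * Z (s i) q) ->
  Z (p ++ t) q = \sum_i c i * Z (p ++ s i) q.
Proof.
move=> Zt; elim: p q => [|a p IH] q //=.
rewrite Z_cons.
under [LHS]eq_bigr do rewrite IH mulr_sumr.
rewrite exchange_big; apply: eq_bigr => i _ /=.
by rewrite Z_cons mulr_sumr; apply: eq_bigr => q' _; rewrite mulrCA.
Qed.

(** Counting the empty one, there are [size s + 1] suffixes, more than the dimension [#|Q|]. *)
Lemma run_dependent (s : seq T) : (#|Q| <= size s)%N ->
  exists (i : 'I_(size s).+1) (c : 'I_(size s).+1 -> K),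
    forall q, Z (drop i s) q
      = \sum_(j : 'I_(size s).+1) (if (i < j)%N then c j else 0) * Z (drop j s) q.
Proof.
move=> Qs; set n := (size s).+1.
pose B : 'M[K]_(n, #|Q|) := \matrix_(i, j) Z (drop i s) (enum_val j).
have : kermx B != 0.
  by rewrite kermx_eq0 /row_free neq_ltn (leq_ltn_trans (rank_leq_col B)).
case/rowV0Pn => v /sub_kermxP vB v0.
have [k vk] : exists k, v ord0 k != 0 by apply/rV0Pn.
(* The least index in the support of the relation is the longest suffix involved; solving for it
   leaves strictly shorter suffixes. *)
case: (@arg_minnP _ k (fun k => v ord0 k != 0) val vk) => i vi imin.
exists i, (fun j => - (v ord0 i)^-1 * v ord0 j) => q.
have /matrixP/(_ ord0 (enum_rank q)) := vB.
rewrite !mxE (bigD1 i) //= !mxE enum_rankK => /eqP.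
rewrite addr_eq0 => /eqP vZ.
apply: (mulfI vi); rewrite {}vZ mulr_sumr -sumrN.
rewrite [RHS](bigD1 i) //= ltnn mul0r mulr0 add0r.
apply: eq_bigr => j ji; rewrite !mxE enum_rankK.
case: ltnP => [_|ij].
  by rewrite mulrA mulrA mulrN mulfV // mulN1r mulNr.
have [->|vj] := eqVneq (v ord0 j) 0; first by rewrite !mul0r mulr0 oppr0.
by case/eqP: ji; apply/val_inj/eqP; rewrite eqn_leq ij imin.
Qed.

Lemma run_eq0 (s : seq T) :
  (forall u, subseq u s -> (size u <= #|Q|)%N -> \sum_q R q * Z u q = 0) ->
  \sum_q R q * Z s q = 0.
Proof.
have [k] := ubnP (size s); elim: k s => // k IH s; rewrite ltnS => sk H.
have [sQ|/ltnW Qs] := leqP (size s) #|Q|; first exact: H.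
have [i [c Hi]] := run_dependent Qs.
rewrite -{1}(cat_take_drop i s).
under [LHS]eq_bigr do rewrite (run_cat_linear _ _ Hi) mulr_sumr.
rewrite exchange_big big1 // => j _ /=.
case: ltnP => [ij|_]; last by apply: big1 => q _; rewrite mul0r mulr0.
under [LHS]eq_bigr do rewrite mulrCA.
(* As [i < j], the word [take i s ++ drop j s] is a strictly shorter subword of [s]. *)
rewrite -mulr_sumr [X in _ * X]IH ?mulr0 //.
  apply: leq_trans sk; rewrite size_cat size_drop size_take_min.
  have := ltn_ord i; have := ltn_ord j; rewrite !ltnS => js is_.
  rewrite (minn_idPl is_) -[X in (_ < X)%N](subnKC js) ltn_add2r //.
move=> u us; apply: H; apply: subseq_trans us _.
rewrite -[X in subseq _ X](cat_take_drop i s) cat_subseq //.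
by rewrite -[j : nat](subnK (ltnW ij)) -drop_drop drop_subseq.
Qed.

End Automaton.

Fixpoint run (K : pzSemiRingType) (Q : finType) (T : Type)
    (A : T -> Q -> Q -> K) (c : Q -> K) (u : seq T) (q : Q) : K :=
  if u is a :: u' then \sum_q' A a q q' * run A c u' q' else c q.

(** The direct sum of the two automata, with the sign of [R2] reversed, computes the difference of
    the two values. *)
Lemma runs_eq (K : fieldType) (Q1 Q2 : finType) (T : eqType)
    (R1 : Q1 -> K) (A1 : T -> Q1 -> Q1 -> K) (c1 : Q1 -> K)
    (R2 : Q2 -> K) (A2 : T -> Q2 -> Q2 -> K) (c2 : Q2 -> K) (s : seq T) :
  (forall u, subseq u s -> (size u <= #|Q1| + #|Q2|)%N ->
     \sum_q R1 q * run A1 c1 u q = \sum_q R2 q * run A2 c2 u q) ->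
  \sum_q R1 q * run A1 c1 s q = \sum_q R2 q * run A2 c2 s q.
Proof.
move=> H.
pose R (q : Q1 + Q2) := match q with inl q => R1 q | inr q => - R2 q end.
pose A a (q q' : Q1 + Q2) := match q, q' with
  | inl q, inl q' => A1 a q q' | inr q, inr q' => A2 a q q' | _, _ => 0 end.
pose Z u (q : Q1 + Q2) := match q with
  | inl q => run A1 c1 u q | inr q => run A2 c2 u q end.
have RZ u : \sum_q R q * Z u q
    = \sum_q R1 q * run A1 c1 u q - \sum_q R2 q * run A2 c2 u q.
  rewrite big_sumType /= -sumrN; congr (_ + _).
  by apply: eq_bigr => q _; rewrite mulNr.
apply/eqP; rewrite -subr_eq0 -RZ; apply/eqP; apply: (run_eq0 (A := A)).
  move=> a u [q|q]; rewrite big_sumType /=.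
    by rewrite [X in _ + X]big1 ?addr0 // => q' _; rewrite mul0r.
  by rewrite [X in X + _]big1 ?add0r // => q' _; rewrite mul0r.
by move=> u us; rewrite card_sum => su; rewrite RZ H // subrr.
Qed.

(** * Gluing partial sums over wire assignments *)

Section Gluing.
Variables (K : comNzRingType) (W X V : finType).
Variables (F : X -> {ffun W -> bool} -> K) (att : V -> pred (W * bool)).
Variables (h : V -> bool -> nat -> nat -> K).
Variables (st : V -> bool -> bool -> nat -> nat -> K).
Hypothesis h_add : forall v t n0 n1 m0 m1,
  h v t (n0 + m0) (n1 + m1) = \sum_t' st v t t' n0 n1 * h v t' m0 m1.

(** Assignments to the wires in [S] are encoded as total ones that are false elsewhere, so that all
    sums range over one type. *)
Definition supported (S : {set W}) (w : {ffun W -> bool}) :=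
  [forall e, w e ==> (e \in S)].

Definition leg_count (S : {set W}) (w : {ffun W -> bool}) v b : nat :=
  \sum_(l | att v l && (l.1 \in S)) (w l.1 == b).

Definition local (S : {set W}) (Y : {set X}) :=
  forall x (w w' : {ffun W -> bool}),
    x \in Y -> {in S, w =1 w'} -> F x w = F x w'.

(** The state sum over the wires in [S], with the shared nodes [V] left open: a vector of
    $(K^2)^{\otimes V}$ in coordinates [q]. Replacing [h] by [st] below gives a matrix on this
    space. *)
Definition partial (S : {set W}) (Y : {set X}) (q : {ffun V -> bool}) : K :=
  \sum_(w | supported S w) (\prod_(x in Y) F x w) *
    \prod_v h v (q v) (leg_count S w v false) (leg_count S w v true).

Definition transfer (S : {set W}) (Y : {set X}) (q q' : {ffun V -> bool}) : K :=
  \sum_(w | supported S w) (\prod_(x in Y) F x w) *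
    \prod_v st v (q v) (q' v) (leg_count S w v false) (leg_count S w v true).

Lemma sum_supportedU (S1 S2 : {set W}) (G : {ffun W -> bool} -> K) :
  [disjoint S1 & S2] ->
  \sum_(w | supported (S1 :|: S2) w) G w
  = \sum_(w1 | supported S1 w1) \sum_(w2 | supported S2 w2)
      G [ffun e => w1 e || w2 e].
Proof.
move=> S12; rewrite pair_big /=.
(* Disjunction glues the two assignments; restricting to each set is the inverse. *)
rewrite (reindex_onto (fun p : {ffun W -> bool} * {ffun W -> bool} =>
     [ffun e => p.1 e || p.2 e] : {ffun W -> bool})
  (fun w : {ffun W -> bool} =>
     ([ffun e => w e && (e \in S1)] : {ffun W -> bool},
      [ffun e => w e && (e \in S2)] : {ffun W -> bool}))) /=; last first.
  move=> w /forallP sw; apply/ffunP => e; rewrite !ffunE -andb_orr.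
  by have := sw e; rewrite inE; case: (w e) => //= ->.
apply: eq_bigl => -[w1 w2] /=; apply/andP/andP => -[].
  move=> _ /eqP [e1 e2]; split; apply/forallP => e; apply/implyP.
    by rewrite -e1 !ffunE => /andP[].
  by rewrite -e2 !ffunE => /andP[].
move=> /forallP s1 /forallP s2; split.
  apply/forallP => e; have := s1 e; have := s2 e; rewrite ffunE inE.
  by case: (w1 e) (w2 e) (e \in S1) (e \in S2) => [] [] [] [].
apply/eqP; congr (_, _); apply/ffunP => e; rewrite !ffunE;
  have := s1 e; have := s2 e; have := disjointFr S12 (x := e);
  case: (w1 e) (w2 e) (e \in S1) (e \in S2) => [] [] [] [] //=;
  by move=> /(_ isT).
Qed.

(** Each factor in [Y1] or [Y2] sees only its own wires, and at a shared node the leg counts of [S1]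
    and [S2] add up, so [h_add] splits its coefficient. *)
Lemma partial_glue (S1 S2 : {set W}) (Y1 Y2 : {set X}) q :
  [disjoint S1 & S2] -> [disjoint Y1 & Y2] -> local S1 Y1 -> local S2 Y2 ->
  partial (S1 :|: S2) (Y1 :|: Y2) q
  = \sum_q' transfer S1 Y1 q q' * partial S2 Y2 q'.
Proof.
move=> S12 Y12 l1 l2; rewrite /partial sum_supportedU //.
under [RHS]eq_bigr do rewrite /transfer mulr_suml.
rewrite [RHS]exchange_big; apply: eq_bigr => w1 /forallP s1 /=.
under [RHS]eq_bigr do rewrite mulr_sumr.
rewrite [RHS]exchange_big; apply: eq_bigr => w2 /forallP s2 /=.
set w := [ffun e => _].
have ww1 : {in S1, w =1 w1}.
  move=> e eS; rewrite ffunE; have := s2 e; rewrite (disjointFr S12 eS).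
  by case: (w2 e) => //; rewrite orbF.
have ww2 : {in S2, w =1 w2}.
  move=> e eS; rewrite ffunE; have := s1 e; rewrite (disjointFl S12 eS).
  by case: (w1 e).
have cw v b : leg_count (S1 :|: S2) w v b
    = (leg_count S1 w1 v b + leg_count S2 w2 v b)%N.
  rewrite /leg_count (bigID (fun l => l.1 \in S1)) /=; congr addn.
    apply: eq_big => l.
      by rewrite inE; case: (l.1 \in S1); rewrite ?andbT ?andbF.
    by case/andP => _ /ww1 ->.
  apply: eq_big => l; last by rewrite inE => /andP[/andP[_ /orP[->|/ww2 ->]]].
  rewrite inE; case e1: (l.1 \in S1); last by rewrite andbT.
  by rewrite (disjointFr S12 e1) !andbF.
rewrite (eq_bigl [predU Y1 & Y2]) => [|x]; last by rewrite !inE.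
rewrite bigU //=.
rewrite (eq_bigr (F^~ w1)) => [|x x1]; last exact: l1 ww1.
rewrite [X in _ * X * _](eq_bigr (F^~ w2)) => [|x x2]; last exact: l2 ww2.
under [\prod_v h _ _ _ _]eq_bigr do rewrite !cw h_add.
(* A product over shared nodes of sums over one state becomes a sum over families [q'] of states. *)
rewrite bigA_distr_bigA mulr_sumr; apply: eq_bigr => q' _.
by rewrite big_split /= -mulrACA.
Qed.

End Gluing.

(** * Spiders *)

(* h t n0 n1 is read with n0 and n1 the numbers of legs carrying 0 and 1: f is
   a combination of two functions h true and h false that span a space stable
   under adding legs, so a bunch of legs is summarised by a vector in K^2. *)
Definition two_state (K : nzRingType) (f : seq bool -> K)
    (r : (bool -> K) * (bool -> nat -> nat -> K) *
         (bool -> bool -> nat -> nat -> K)) : Prop :=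
  let rho := r.1.1 in let h := r.1.2 in let st := r.2 in
  (forall s, f s = \sum_t rho t * h t (count negb s) (count id s)) /\
  (forall t n0 n1 m0 m1, h t (n0 + m0)%N (n1 + m1)%N
     = \sum_t' st t t' n0 n1 * h t' m0 m1).

(** Except for the black ZW spider, the two functions are multiplicative in the leg counts, so the
    transitions are diagonal. *)
Lemma spider_two_state (C : calculus) (a : label C) (p : phase C) :
  arity a = None -> exists r, two_state (coef a p) r.
Proof.
have all0 (s : seq bool) : all negb s = (count id s == 0)%N.
  by elim: s => // -[] s //= ->.
have all1 (s : seq bool) : all id s = (count negb s == 0)%N.
  by elim: s => // -[] s //= ->.
have white (K : fieldType) (r : K) : exists r', two_state (spider_coef r) r'.
  pose h (t : bool) (n0 n1 : nat) : K := ((if t then n0 else n1) == 0%N)%:R.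
  exists (fun t => if t then r else 1, h,
          fun t t' n0 n1 => (t == t')%:R * h t n0 n1); split=> [s|t n0 n1 m0 m1].
    by rewrite big_bool /= /spider_coef all0 all1 mul1r addrC.
  rewrite big_bool /h; case: t; rewrite /= !addn_eq0 ?mul1r ?mul0r ?addr0 ?add0r;
    by rewrite -natrM mulnb.
case: C a p => [R|K half|K] [|[]] //= p _; try exact: white.
(* X spider: the product states of |+> and |->, the latter with a sign for each leg carrying 1. *)
- pose c := inv_sqrt2 R.
  pose h (t : bool) (n0 n1 : nat) : R[i] := c ^+ (n0 + n1) * (-1) ^+ (t * n1).
  exists (fun t => if t then expi p else 1, h,
          fun t t' n0 n1 => (t == t')%:R * h t n0 n1); split=> [s|t n0 n1 m0 m1].
    rewrite big_bool /= mul1r addrC /h; congr (_ + _ * _).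
      by rewrite mul0n mulr1; elim: s => [|[] s IH];
         rewrite ?big_nil ?big_cons ?IH //= ?add0n ?addnS ?addSn exprS.
    rewrite mul1n; elim: s => [|[] s IH]; rewrite ?big_nil ?big_cons ?IH //=.
      by rewrite mulr1.
      by rewrite addnA addn1 add0n !exprS /c; ring.
    by rewrite add1n add0n addSn !exprS /c; ring.
  rewrite big_bool /h; case: t;
    rewrite /= ?mul1r ?mul0r ?addr0 ?add0r ?mul1n ?mul0n ?mulr1;
    by rewrite addnACA !exprD //; ring.
(* H-box: $1 + (r-1)\prod b$, the constant 1 plus a multiple of the indicator that no leg carries
   0. *)
- pose h (t : bool) (n0 n1 : nat) : K := if t then (n0 == 0%N)%:R else 1.
  exists (fun t => if t then p - 1 else 1, h,
          fun t t' n0 n1 => (t == t')%:R * h t n0 n1); split=> [s|t n0 n1 m0 m1].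
    rewrite big_bool /= mul1r -all1 /zh_coef.
    have -> : (\prod_(b <- s) nat_of_bool b)%N = all id s.
      by elim: s => [|b s IH]; rewrite ?big_nil ?big_cons ?IH //= mulnb.
    by case: (all id s); rewrite ?expr1 ?expr0 ?mulr1 ?mulr0 ?add0r ?subrK.
  rewrite big_bool /h; case: t; rewrite /= ?mul1r ?mul0r ?addr0 ?add0r //.
  by rewrite addn_eq0 -natrM mulnb.
(* Black spider: [~~ t] is the number of 1s still to be met, and legs already read lower it by
   [n1]. *)
- pose h (t : bool) (n0 n1 : nat) : K := (n1 == ~~ t)%:R.
  exists (fun t => (~~ t)%:R, h,
          fun t t' (n0 n1 : nat) => (n1 + ~~ t' == ~~ t)%N%:R);
    split=> [s|t n0 n1 m0 m1].
    by rewrite big_bool /= mul0r add0r mul1r.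
  rewrite big_bool /= /h.
  by case: t; case: n1 m1 => [|[|n1]] [|[|m1]];
    rewrite /= ?addnS ?addn0 ?mul0r ?mulr0 ?mul1r ?addr0 ?add0r.
Qed.

(** Ports at a spider may coincide, so sorting can list its legs in another order after an
    embedding. *)
Lemma coef_perm (C : calculus) (a : label C) (p : phase C) (s t : seq bool) :
  arity a = None -> perm_eq s t -> coef a p s = coef a p t.
Proof.
move=> /(spider_two_state p) [r [Hr _]] /permP st.
by rewrite !Hr !st.
Qed.

(** * State sums of sub-diagrams *)

Section Legs.
Variables (C : calculus) (P : Type) (I O : finType) (D : diagram C P I O).

Lemma mem_legs (v : node D) l : (l \in legs v) = (endpoint l == inl v).
Proof. by rewrite mem_sort mem_filter mem_enum andbT. Qed.

Lemma legs_uniq (v : node D) : uniq (legs v).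
Proof. by rewrite sort_uniq filter_uniq // enum_uniq. Qed.

End Legs.

Section SubDiagram.
Variables (C : calculus) (I O : finType) (G : diagram C (phase C) I O).

Definition end_agrees (w : {ffun wire G -> bool}) (x : {ffun I -> bool})
    (y : {ffun O -> bool}) (l : wire G * bool) : bool :=
  match endpoint l with
  | inl _ => true
  | inr (inl i) => w l.1 == x i
  | inr (inr o) => w l.1 == y o
  end.

Definition node_coef (v : node G) (s : seq bool) : scalars C :=
  coef (node_label v) (node_phase v) s.

(** Legs on wires outside [SW] are deleted, not set to a fixed bit: a spider losing some neighbours
    becomes a spider of smaller arity. *)
Definition sub_amplitude (SW : {set wire G}) (SV : {set node G})
    (y : {ffun O -> bool}) (x : {ffun I -> bool}) : scalars C :=
  \sum_(w | supported SW w)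
    (\prod_(l | l.1 \in SW) (end_agrees w x y l)%:R) *
    \prod_(v in SV) node_coef v [seq w l.1 | l <- legs v & l.1 \in SW].

Hypothesis port_inj : forall v : node G,
  arity (node_label v) != None -> {in legs v &, injective (@port _ _ _ _ G)}.

(** Extension by zero matches the wire assignments, and the legs of an image node on image wires are
    the images of its legs in [G']. This serves for the identity and for the inclusion of an
    instance with fewer copies. *)
Lemma amplitude_embed (I' O' : finType) (G' : diagram C (phase C) I' O')
    (fI : I' -> I) (fO : O' -> O) (fV : node G' -> node G)
    (fW : wire G' -> wire G)
    (x : {ffun I -> bool}) (y : {ffun O -> bool}) :
  injective fV -> injective fW ->
  (forall v, node_label (fV v) = node_label v) ->
  (forall v, node_phase (fV v) = node_phase v) ->
  (forall e s, port (fW e, s) = port (e, s)) ->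
  (forall e s, endpoint (fW e, s) =
     match endpoint (e, s) with
     | inl v => inl (fV v)
     | inr (inl i) => inr (inl (fI i))
     | inr (inr o) => inr (inr (fO o))
     end) ->
  amplitude G' [ffun o => y (fO o)] [ffun i => x (fI i)]
  = sub_amplitude (fW @: setT) (fV @: setT) y x.
Proof.
move=> injV injW labelE phaseE portE endE; rewrite /amplitude /sub_amplitude.
pose f (l : wire G' * bool) := (fW l.1, l.2).
have injf : injective f by move=> [e s] [e' s'] [/injW -> ->].
pose g (w : {ffun wire G' -> bool}) : {ffun wire G -> bool} :=
  [ffun e => [exists e', (fW e' == e) && w e']].
have gE w e : g w (fW e) = w e.
  rewrite ffunE; apply/existsP/idP => [[e' /andP[/eqP/injW ->]]|we] //.
  by exists e; rewrite eqxx.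
rewrite [RHS](reindex g) /=; last first.
  exists (fun w : {ffun wire G -> bool} =>
      [ffun e => w (fW e)] : {ffun wire G' -> bool}).
    by move=> w _; apply/ffunP => e; rewrite ffunE gE.
  move=> w /forallP sw; apply/ffunP => e; case we: (w e).
    have := sw e; rewrite we => /imsetP[e' _ ee].
    by rewrite ee gE ffunE -ee.
  rewrite ffunE; apply/existsP => -[e' /andP[/eqP ee]].
  by rewrite ffunE ee we.
rewrite big_mkcond [RHS](eq_bigl predT) /=; last first.
  move=> w; apply/forallP => e; apply/implyP;
  rewrite ffunE => /existsP[e' /andP[/eqP <- _]]; by rewrite imset_f.
apply: eq_bigr => w _.
have fSW l : (l.1 \in fW @: setT) = (l \in f @: setT).
  apply/imsetP/imsetP => -[] => [e _ le|l' _ ->]; last by exists l'.1.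
  by exists (e, l.2) => //; rewrite /f /= -le; case: (l).
rewrite -mulrb -mulr_natl; congr (_ * _).
  rewrite (eq_bigl _ _ fSW) big_imset => [|l l' _ _ /injf //] /=.
  case: (boolP (agrees _ _ _)) => [/forallP ag|]; last first.
    rewrite negb_forall => /existsP[[e s] Hl]; apply/esym.
    rewrite (bigD1 (e, s)) ?inE //= /end_agrees endE /= gE.
    by move: Hl; case: (endpoint _) => [v|[i|o]] //=; rewrite ffunE => /negbTE ->;
       rewrite mul0r.
  rewrite big1 // => -[e s] _; have := ag (e, s); rewrite /end_agrees endE /= gE.
  by case: (endpoint _) => [v|[i|o]] //=; rewrite ffunE => ->.

rewrite big_imset => [|v v' _ _ /injV //] /=.
apply: eq_big => v; rewrite ?inE // => _.
rewrite /node_coef labelE phaseE.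
set s0 := legs v; set s1 := [seq l <- legs (fV v) | _].
have s01 : perm_eq s1 [seq f l | l <- s0].
  apply: uniq_perm; rewrite ?filter_uniq ?map_inj_uniq ?legs_uniq //.
  move=> l; rewrite mem_filter fSW mem_legs; apply/andP/mapP.
    move=> [/imsetP[[e s] _ ->]]; rewrite endE => H; exists (e, s) => //.
    by rewrite mem_legs; move: H; case: (endpoint _) => [v'|[]] //= /eqP[/injV ->].
  move=> [[e s]]; rewrite mem_legs => /eqP H ->; split; first exact: imset_f.
  by rewrite endE H.
have -> : [seq w l.1 | l <- s0] = [seq g w l.1 | l <- [seq f l | l <- s0]].
  by rewrite -map_comp; apply: eq_map => l /=; rewrite gE.
(* The order of the legs is immaterial at a spider; at a node of fixed arity distinct ports leave
   only one sorted order. *)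
have [spider|fixed] := eqVneq (arity (node_label v)) None.
  by apply: coef_perm => //; apply: perm_map; rewrite perm_sym.
congr (coef _ _ (map _ _)); apply/esym.
have leT : total (relpre (@port _ _ _ _ G) leq) by move=> ? ?; exact: leq_total.
have trT : transitive (relpre (@port _ _ _ _ G) leq).
  by move=> ? ? ? /=; exact: leq_trans.
apply: (sorted_eq_in (leT := relpre (@port _ _ _ _ G) leq)) => //.
- by move=> ? ? ? _ _ _; exact: trT.
- move=> l l'; rewrite !mem_filter => /andP[_ il] /andP[_ il'] /anti_leq.
  by apply: port_inj il il'; rewrite labelE.
- by apply: sorted_filter => //; exact: sort_sorted.
rewrite sorted_map; apply: (sub_sorted _ (sort_sorted _ _)).
  by move=> [e s] [e' s'] /=; rewrite !portE.
by move=> ? ?; exact: leq_total.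
Qed.
End SubDiagram.

(** * Layered diagrams *)

Section Layers.
Variables (C : calculus) (I O : finType) (G : diagram C (phase C) I O).
Variables (L : eqType) (l0 : L) (wlay : wire G -> L) (vlay : node G -> L).
Variables (x : {ffun I -> bool}) (y : {ffun O -> bool}).

(* Distinct layers other than l0 only interact through these nodes. *)
Definition bridges : {set node G} :=
  [set v | (vlay v == l0) &&
           [exists l, (endpoint l == inl v) && (wlay l.1 != l0)]].

Hypothesis wlay_leg : forall v l,
  endpoint l = inl v -> vlay v != l0 -> wlay l.1 = vlay v.
Hypothesis bridge_spider : forall v, v \in bridges -> arity (node_label v) = None.

Definition wires_in (ls : seq L) : {set wire G} := [set e | wlay e \in ls].
Definition nodes_in (ls : seq L) : {set node G} := [set v | vlay v \in ls].

Let V := 'I_#|bridges|.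
Let X := (node G + wire G * bool)%type.
Let att (i : V) (l : wire G * bool) := endpoint l == inl (enum_val i).
Let F (z : X) (w : {ffun wire G -> bool}) : scalars C :=
  match z with
  | inl v => node_coef v [seq w l.1 | l <- legs v]
  | inr l => (end_agrees w x y l)%:R
  end.
Let Y (ls : seq L) : {set X} :=
  [set z | match z with
           | inl v => (v \notin bridges) && (vlay v \in ls)
           | inr l => wlay l.1 \in ls
           end].

Let wires_cons a u : wires_in (a :: u) = wires_in [:: a] :|: wires_in u.
Proof. by apply/setP => e; rewrite !inE. Qed.

Let Y_cons a u : Y (a :: u) = Y [:: a] :|: Y u.
Proof. by apply/setP => -[v|l]; rewrite !inE ?andb_orr. Qed.

Let leg_layer v l : v \notin bridges -> endpoint l = inl v -> wlay l.1 = vlay v.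
Proof.
move=> vb vl; have [v0|] := eqVneq (vlay v) l0; last exact: wlay_leg.
rewrite v0; move: vb; rewrite inE v0 eqxx /= negb_exists => /forallP/(_ l).
by rewrite vl eqxx /= negbK => /eqP.
Qed.

Let F_local ls : local F (wires_in ls) (Y ls).
Proof.
move=> [v|l] w w'; rewrite inE /=.
  move=> /andP[vb vls] ww; congr (node_coef _); apply/eq_in_map => l.
  by rewrite mem_legs => /eqP lv; apply: ww; rewrite inE (leg_layer vb lv).
move=> lls ww; rewrite /end_agrees; case: (endpoint l) => [//|[i|o]];
  by rewrite ww // inE.
Qed.

(** All bridges lie in the layer [l0], hence among the nodes kept, so their factors can be split
    off. *)
Let sub_amplitudeE u : l0 \in u ->
  sub_amplitude (wires_in u) (nodes_in u) y x
  = \sum_(w | supported (wires_in u) w)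
      (\prod_(z in Y u) F z w) *
      \prod_(i < #|bridges|) node_coef (enum_val i)
         [seq w l.1 | l <- legs (enum_val i) & l.1 \in wires_in u].
Proof.
move=> u0; apply: eq_bigr => w _.
rewrite (bigID (mem bridges)) /= mulrCA mulrC; congr (_ * _); last first.
  rewrite -(big_enum_val (fun v =>
    node_coef v [seq w l.1 | l <- legs v & l.1 \in wires_in u])).
  apply: eq_bigl => v /=; rewrite inE.
  case vb: (v \in bridges); rewrite ?andbF // andbT; move: vb.
  by rewrite inE => /andP[/eqP ->].
rewrite big_sumType mulrC /=; congr (_ * _).
  apply: eq_big => v; first by rewrite !inE andbC.
  move=> /andP[vu vb]; congr (node_coef _ _); congr map.
  apply/all_filterP/allP => l; rewrite mem_legs => /eqP lv.
  by rewrite inE (leg_layer vb lv); rewrite inE in vu.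
by apply: eq_bigl => l; rewrite !inE.
Qed.

(** The layer [l0] is always present and is absorbed into [R]; every other layer acts by its
    transfer matrix on the joint states of the bridges. *)
Lemma layered_automaton :
  exists (R : {ffun V -> bool} -> scalars C)
         (A : L -> {ffun V -> bool} -> {ffun V -> bool} -> scalars C)
         (c : {ffun V -> bool} -> scalars C),
  forall u, uniq (l0 :: u) ->
    sub_amplitude (wires_in (l0 :: u)) (nodes_in (l0 :: u)) y x
    = \sum_q R q * run A c u q.
Proof.
have /fin_all_exists [r Hr] (i : V) := spider_two_state
  (node_phase (enum_val i)) (bridge_spider (enum_valP i)).
pose h i := (r i).1.2; pose st i := (r i).2; pose rho i := (r i).1.1.
have hadd i := (Hr i).2.
pose A a := transfer F att st (wires_in [:: a]) (Y [:: a]).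
pose Z u := partial F att h (wires_in u) (Y u).
have legE u w i b : leg_count att (wires_in u) w i b
    = count (pred1 b) [seq w l.1 | l <- legs (enum_val i) & l.1 \in wires_in u].
  rewrite count_map -sum1_count big_filter_cond.
  rewrite (perm_big _ (permEl (perm_sort _ _))) big_filter_cond big_enum_cond /=.
  under [RHS]eq_bigl do rewrite andbA.
  by rewrite [RHS]big_mkcondr; apply: eq_bigr => l _; case: eqP.
(* Distinct layers have disjoint wires and factors; a repeated letter would break this. *)
have Z_cons a u q : uniq (a :: u) -> Z (a :: u) q = \sum_q' A a q q' * Z u q'.
  move=> /andP[au _]; rewrite /Z wires_cons Y_cons (partial_glue att hadd) //.
  - by rewrite disjoints_subset; apply/subsetP => e; rewrite !inE => /eqP ->.
  - rewrite disjoints_subset; apply/subsetP => -[v|l]; rewrite !inE.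
      by move=> /andP[_ /eqP ->]; rewrite negb_and au orbT.
    by move=> /eqP ->.
have runE u q : uniq u -> run A (Z [::]) u q = Z u q.
  elim: u q => // a u IH q au; rewrite Z_cons //=.
  by apply: eq_bigr => q' _; rewrite IH //; case/andP: au.
exists (fun q =>
  \sum_(q' : {ffun V -> bool}) (\prod_i rho i (q' i)) * A l0 q' q), A, (Z [::]).
move=> u u0.
transitivity (\sum_(q : {ffun V -> bool}) (\prod_i rho i (q i)) * Z (l0 :: u) q).
  rewrite sub_amplitudeE ?mem_head //.
  under [RHS]eq_bigr do rewrite /Z /partial mulr_sumr.
  rewrite exchange_big; apply: eq_bigr => w _ /=.
  under [RHS]eq_bigr do rewrite mulrCA -big_split /=.
  rewrite -mulr_sumr; congr (_ * _).
  (* The coefficient of each bridge is expanded over its two states. *)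
  rewrite -(bigA_distr_bigA (fun i t => rho i t * h i t _ _)).
  apply: eq_bigr => i _; rewrite /node_coef (Hr i).1.
  apply: eq_bigr => t _; congr (_ * h i t _ _).
    by rewrite legE; apply/eq_count => -[].
  by rewrite legE; apply/eq_count => -[].
under eq_bigr do rewrite Z_cons // mulr_sumr.
rewrite exchange_big; apply: eq_bigr => q _ /=.
rewrite mulr_suml runE; last by case/andP: u0.
by apply: eq_bigr => q' _; rewrite mulrA.
Qed.
End Layers.

(** * Instances *)

Lemma sval_copies_inj (m : nat) (d : 'I_m -> nat) (T : finType)
    (box : T -> {set 'I_m}) (p q : copies d box) :
  sval p = sval q -> p = q.
Proof. exact: val_inj. Qed.

Section EmbedCopies.
Variables (m : nat) (d : 'I_m -> nat) (delta : 'I_m) (u : seq nat).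
Hypotheses (u_uniq : uniq u) (u_lt : all (gtn (d delta)) u).

(* None collects what lies outside delta, and Some i the i-th copy of delta. *)
Definition layer (T : finType) (box : T -> {set 'I_m}) (p : copies d box) :
    option nat :=
  if delta \in box (sval p).1 then Some (val ((sval p).2 delta)) else None.

Definition resize (j : 'I_m) : nat := if j == delta then size u else d j.

Definition embed_nat (j : 'I_m) (c : nat) : nat :=
  if j == delta then nth 0 u c else c.

(* The i-th copy of delta in the smaller instance becomes the copy u_i. *)
Definition embed_index (B : {set 'I_m}) (c : copy_index resize) : copy_index d :=
  [ffun j => if j \in B then inord (embed_nat j (c j)) else ord0].

Lemma embed_nat_lt j c : (c < resize j -> embed_nat j c < d j)%N.
Proof.
rewrite /resize /embed_nat; case: eqP => [->|//] cu.
by apply: (allP u_lt); exact: mem_nth.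
Qed.

(** The bound in the type of copy numbers is a maximum over all !-boxes and depends on the instance;
    [inord] truncates nothing because [embed_nat] stays below [d j]. *)
Lemma embed_indexE B c j : copy_of B c -> j \in B ->
  embed_index B c j = embed_nat j (c j) :> nat.
Proof.
move=> /forallP/(_ j) cB jB; rewrite ffunE jB inordK //.
rewrite jB in cB; rewrite ltnS; apply: leq_trans (leq_bigmax j).
exact/ltnW/embed_nat_lt.
Qed.

Lemma copy_of_embed B c : copy_of B c -> copy_of B (embed_index B c).
Proof.
move=> cB; apply/forallP => j; case: ifP => jB; last by rewrite ffunE jB.
rewrite (embed_indexE cB jB); apply: embed_nat_lt.
by move/forallP/(_ j): cB; rewrite jB.
Qed.

Definition embed_copy (T : finType) (box : T -> {set 'I_m})
    (p : copies resize box) : copies d box :=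
  exist _ ((sval p).1, embed_index (box (sval p).1) (sval p).2)
    (copy_of_embed (svalP p)).

Lemma copy_of_out (d' : 'I_m -> nat) B (c : copy_index d') j :
  copy_of B c -> j \notin B -> c j = ord0.
Proof.
move=> /forallP/(_ j) cB jB; apply/val_inj/eqP.
by rewrite (negbTE jB) ltnS leqn0 in cB.
Qed.

Lemma embed_copy_inj (T : finType) (box : T -> {set 'I_m}) :
  injective (@embed_copy T box).
Proof.
move=> [[t c] h] [[t' c'] h'] /(congr1 val) /= [tt' /ffunP cc'].
subst t'; apply: val_inj => /=; congr (_, _); apply/ffunP => j.
rewrite /= in h h'; have [jB|jB] := boolP (j \in box t); last first.
  by rewrite (copy_of_out h jB) (copy_of_out h' jB).
have /(congr1 val) := cc' j; rewrite /= !embed_indexE // /embed_nat => e.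
apply: val_inj => /=; move: e; case: eqP => // jd /eqP.
move: (forallP h j) (forallP h' j); rewrite jB /resize jd eqxx => cj cj'.
by rewrite nth_uniq // => /eqP.
Qed.

(** Only the copy number for [delta] changes, and it runs through the entries of [u]; all that lies
    outside [delta] is kept. *)
Lemma embed_copy_image (T : finType) (box : T -> {set 'I_m}) :
  @embed_copy T box @: setT = [set p | layer p \in None :: map Some u].
Proof.
apply/setP => -[[t c] h]; rewrite inE; apply/imsetP/idP => [[[[t' c'] h'] _ e]|].
  rewrite {}e /layer /=; case: ifP => // db.
  have {}h' : copy_of (box t') c' := h'.
  rewrite inE /= embed_indexE // mem_map; last by move=> ? ? [].
  rewrite /embed_nat eqxx mem_nth //.
  by have := forallP h' delta; rewrite db /resize eqxx.
have hc : copy_of (box t) c := h.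
rewrite /layer /= => lu.
(* The preimage replaces the copy number of [delta] by its position in [u]. *)
pose inv j (k : nat) : nat := if j == delta then index k u else k.
have inv_lt j : j \in box t -> (inv j (c j) < resize j)%N.
  move=> jb; rewrite /inv /resize; case: eqP => [jd|_]; last first.
    by have := forallP hc j; rewrite jb.
  move: lu; rewrite -jd jb inE /= mem_map; last by move=> ? ? [].
  by rewrite index_mem.
pose c' : copy_index resize :=
  [ffun j => if j \in box t then inord (inv j (c j)) else ord0].
have c'E j : j \in box t -> c' j = inv j (c j) :> nat.
  move=> jb; rewrite ffunE jb inordK // ltnS.
  by apply: leq_trans (leq_bigmax j); apply/ltnW/inv_lt.
have h' : copy_of (box t) c'.
  apply/forallP => j; case: ifP => jb; last by rewrite ffunE jb.
  by rewrite c'E // inv_lt.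
exists (exist _ (t, c') h'); first by rewrite inE.
apply: sval_copies_inj => /=; congr (_, _).
apply/ffunP => j; have [jb|jb] := boolP (j \in box t); last first.
  by rewrite (copy_of_out hc jb) ffunE (negbTE jb).
apply: val_inj; rewrite /= embed_indexE // c'E // /embed_nat /inv.
case: eqP => // jd; rewrite nth_index //.
by move: lu; rewrite -jd jb inE /= mem_map // => ? ? [].
Qed.

Lemma restrict_embed (A B : {set 'I_m}) c : A \subset B ->
  restrict_index A (embed_index B c) = embed_index A (restrict_index A c).
Proof.
move=> /subsetP AB; apply/ffunP => j; rewrite !ffunE.
by case: ifP => // jA; rewrite (AB _ jA).
Qed.

End EmbedCopies.

Lemma uniq_map_inj_in (T T' : eqType) (f : T -> T') (s : seq T) :
  uniq (map f s) -> {in s &, injective f}.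
Proof.
elim: s => // a s IH /= /andP[fa fs] x y; rewrite !inE.
case/predU1P=> [->|xs] /predU1P[->|ys] // fxy.
- by rewrite fxy map_f in fa.
- by rewrite -fxy map_f in fa.
exact: IH.
Qed.

(** * Layers of an instance and the number of bridges *)

Section InstanceLayers.
Variables (C : calculus) (n m : nat) (F : interface m) (D : pattern C n F).
Variables (alpha : 'I_n -> phase C) (d : 'I_m -> nat) (delta : 'I_m).
Hypothesis D_valid : valid_pattern D.
Hypothesis D_separated : forall j, j != delta ->
  separated D delta j /\ ~~ nested D delta j.

Notation G := (instantiate D alpha d).

Lemma copy_vertex_node (z : vertex D) (c : copy_index d)
    (h : copy_of (vertex_box z) c) (v : inst_node D d) :
  copy_vertex h = inl v -> z = inl (sval v).1 /\ c = (sval v).2.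
Proof. by case: z h => [w|[i|o]] h //= [<-]. Qed.

Lemma instance_leg (v : node G) (l : wire G * bool) : endpoint l = inl v ->
  endpoint ((sval l.1).1, l.2) = inl (sval v).1 /\
  restrict_index (node_box D (sval v).1) (sval l.1).2 = (sval v).2.
Proof. by move=> /copy_vertex_node [-> ->] /=. Qed.

(** A !-box marking the other end of the wire but not [v] would force [v] to be a spider. *)
Lemma fixed_arity_wire_box (v : node D) (e : wire D) (s : bool) :
  arity (node_label v) != None -> endpoint (e, s) = inl v ->
  wire_box e = node_box D v.
Proof.
move=> av ev; have [_ js _] := D_valid.
apply/eqP; rewrite eqEsubset; apply/andP; split; last first.
  by have := end_sub_wire e s; rewrite ev.
apply/subsetP => k ke; apply/idP/idP; apply: contraT => kv.
have := js e s k; rewrite ev /= => /(_ kv); rewrite (negbTE av) => H.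
apply: H; move: ke; rewrite /wire_box inE.
by case: s ev => -> /=; rewrite (negbTE kv) ?orbF.
Qed.

(** Equal ports come from the same wire end of the pattern, and the copy number of the wire is that
    of [v], since both lie in the same !-boxes. *)
Lemma instance_port_inj (v : node G) : arity (node_label v) != None ->
  {in legs v &, injective (@port _ _ _ _ G)}.
Proof.
move=> av [e s] [e' s']; rewrite !mem_legs => /eqP/instance_leg /= [es ce].
move=> /eqP/instance_leg /= [es' ce'] pp.
have [[_ wf] _ _] := D_valid.
have eqe : ((sval e).1, s) = ((sval e').1, s').
  case ak: (arity (node_label v)) av => [k|] // _.
  have /(congr1 uniq) := wf _ _ ak; rewrite iota_uniq => pu.
  by apply: (uniq_map_inj_in pu) => //; rewrite mem_legs ?es ?es' eqxx.
case: eqe => ee ss; rewrite ss; congr (_, _); apply: sval_copies_inj.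
have bv := fixed_arity_wire_box av es; have bv' := fixed_arity_wire_box av es'.
case: e e' ee ce ce' bv bv' {es es' pp} => [[e c] h] [[e' c'] h'] /= ee ce ce' bv bv'.
subst e'; congr (_, _); apply/ffunP => j.
have [jb|jb] := boolP (j \in wire_box e).
  move/ffunP/(_ j): ce; move/ffunP/(_ j): ce'; rewrite !ffunE -bv jb.
  by move=> -> ->.
by rewrite (copy_of_out h jb) (copy_of_out h' jb).
Qed.

Definition wire_layer (e : wire G) : option nat := layer delta e.
Definition node_layer (v : node G) : option nat := layer delta v.

Lemma node_layer_leg (v : node G) (l : wire G * bool) :
  endpoint l = inl v -> node_layer v != None -> wire_layer l.1 = node_layer v.
Proof.
move=> /instance_leg [ev cv]; rewrite /wire_layer /node_layer /layer.
case: ifP => // vb _.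
have := end_sub_wire (sval l.1).1 l.2; rewrite ev => /subsetP -> //.
by congr Some; rewrite -cv ffunE vb.
Qed.

Let B := bridges None wire_layer node_layer.

Lemma bridge_join (v : node G) : v \in B ->
  exists e s, [/\ endpoint (e, s) = inl (sval v).1,
    delta \notin node_box D (sval v).1 &
    delta \in vertex_box (endpoint (e, ~~ s))].
Proof.
rewrite inE => /andP[v0 /existsP[l /andP[/eqP/instance_leg [ev _] l0]]].
have vb : delta \notin node_box D (sval v).1.
  by move: v0; rewrite /node_layer /layer; case: ifP.
exists (sval l.1).1, l.2; split => //.
move: l0; rewrite /wire_layer /layer; case: ifP => //.
by case: l.2 ev => ev; rewrite inE ev /= (negbTE vb) ?orbF.
Qed.

Lemma bridge_spider (v : node G) : v \in B -> arity (node_label v) = None.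
Proof.
move=> /bridge_join [e [s [ev vb db]]]; have [_ js _] := D_valid.
have := js e s delta; rewrite ev /= => /(_ vb db) /eqP ->.
by [].
Qed.

(** Let another !-box [j] mark the node. If [j] were nested in [delta], then [delta] would mark it
    too; [delta] is nested in nothing; and otherwise the join wire would connect [delta] to [j],
    against separation. *)
Lemma bridge_box (v : node G) : v \in B -> node_box D (sval v).1 = set0.
Proof.
move=> /bridge_join [e [s [ev vb db]]]; have [_ _ [_ _ nest]] := D_valid.
apply/setP => j; rewrite inE; apply/negP => jv.
have [jd|jd] := eqVneq j delta; first by rewrite -jd jv in vb.
have [[nj|nj|sep] nnj] := D_separated jd.
- by rewrite nj in nnj.
- by have := nest _ _ (inl (sval v).1) nj jv; rewrite /= (negbTE vb).
by have := sep e (~~ s); rewrite db negbK ev /= jv.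
Qed.

(** Lying in no !-box, a bridge has a single copy, so bridges amount to nodes of the pattern, each
    the outer end of some wire of the join. *)
Lemma card_bridges : (#|B| <= join_size D delta)%N.
Proof.
(* On a wire of the join this selects the end outside [delta]: end [true] exactly when end [false]
   is marked. *)
pose out (e : wire D) := endpoint (e, delta \in vertex_box (endpoint (e, false))).
rewrite -(card_in_imset (f := fun v : node G => inl (sval v).1 : vertex D)).
  apply: leq_trans (leq_imset_card out (join D delta)).
  apply/subset_leq_card/subsetP => _ /imsetP[v /bridge_join [e [s [ev vb db]]] ->].
  apply/imsetP; exists e.
    by rewrite inE; case: s ev db => ev db; rewrite ev db /= (negbTE vb).
  rewrite /out -ev; congr (endpoint (e, _)).
  by case: s ev db => ev db; [rewrite db | rewrite ev /= (negbTE vb)].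
move=> v v' vB v'B [vv]; apply: sval_copies_inj.
have := bridge_box vB; have := bridge_box v'B; move: vv {vB v'B}.
case: v v' => [[v c] h] [[v' c'] h'] /= vv _ v0; subst v'; congr (_, _).
apply/ffunP => j; have jv : j \notin node_box D v by rewrite v0 inE.
by rewrite (copy_of_out h jv) (copy_of_out h' jv).
Qed.

Definition layers_amplitude (ls : seq (option nat))
    (y : {ffun inst_out F d -> bool}) (x : {ffun inst_in F d -> bool}) :=
  @sub_amplitude C _ _ G (wires_in wire_layer ls) (nodes_in node_layer ls) y x.

Lemma amplitude_layers (y : {ffun inst_out F d -> bool})
    (x : {ffun inst_in F d -> bool}) :
  amplitude G y x = layers_amplitude (None :: map Some (iota 0 (d delta))) y x.
Proof.
have := @amplitude_embed C _ _ G instance_port_inj _ _ G id id id id x y.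
have -> : [ffun o => y (id o)] = y by apply/ffunP => o; rewrite ffunE.
have -> : [ffun i => x (id i)] = x by apply/ffunP => i; rewrite ffunE.
move=> -> //; last by move=> e s; case: (endpoint _) => [|[]].
have full (T : finType) (box : T -> {set 'I_m}) (p : copies d box) :
    layer delta p \in None :: map Some (iota 0 (d delta)).
  rewrite /layer; case: ifP => // db; rewrite inE /= mem_map => [|? ? [] //].
  rewrite mem_iota /=; have := forallP (svalP p) delta; by rewrite db.
congr sub_amplitude; apply/setP => p; rewrite [RHS]inE full;
  by apply/imsetP; exists p.
Qed.

(** The boundary bits are those of the large instance, restricted to the copies kept. Copies with
    different bits may act by different matrices, hence subwords instead of powers of one matrix. *)
Lemma amplitude_resize (u : seq nat) (y : {ffun inst_out F d -> bool})
    (x : {ffun inst_in F d -> bool}) (u_lt : all (gtn (d delta)) u) :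
  uniq u ->
  amplitude (instantiate D alpha (resize d delta u))
    [ffun o => y (embed_copy u_lt o)] [ffun i => x (embed_copy u_lt i)]
  = layers_amplitude (None :: map Some u) y x.
Proof.
move=> uu; rewrite (@amplitude_embed C _ _ G instance_port_inj _ _
  (instantiate D alpha (resize d delta u))
  (embed_copy u_lt (box := _)) (embed_copy u_lt (box := _))
  (embed_copy u_lt (box := _)) (embed_copy u_lt (box := _))) //.
- by congr sub_amplitude; apply: embed_copy_image.
- exact: embed_copy_inj.
- exact: embed_copy_inj.
move=> e s; rewrite /= /inst_endpoint /=.
set h1 := restrict_copy_of _ _; set h2 := restrict_copy_of _ _.
move: h1 h2; rewrite restrict_embed ?end_sub_wire //.
case: (endpoint _) => [v|[i|o]] h1 h2 /=; do ?congr (inl _); do ?congr (inr _);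
  do ?congr (inl _); do ?congr (inr _); exact: sval_copies_inj.
Qed.

End InstanceLayers.

Local Close Scope ring_scope.

Theorem theorem8p51 (C : calculus) (n m : nat) (E : equation C n m)
    (delta1 : 'I_m) (hdelta1 : outer_separated E delta1) :
  let N := join_dim (lhs E) delta1 + join_dim (rhs E) delta1 in
  (forall c : nat, c <= N -> sound_at E delta1 c) -> sound E.
Proof.
move=> N sound_small alpha d.
have sepL j : j != delta1 ->
  separated (lhs E) delta1 j /\ ~~ nested (lhs E) delta1 j.
  by case/hdelta1.
have sepR j : j != delta1 ->
  separated (rhs E) delta1 j /\ ~~ nested (rhs E) delta1 j.
  by case/hdelta1.
apply/matrixP => j i; rewrite !mxE; move: (enum_val j) (enum_val i) => y x.
rewrite (amplitude_layers _ delta1 (lhs_valid E)).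
rewrite (amplitude_layers _ delta1 (rhs_valid E)).
(* For fixed boundary bits both sides become automata reading the same word of copies of
   [delta1]. *)
have [R1 [A1 [c1 H1]]] := layered_automaton x y
  (@node_layer_leg _ _ _ _ (lhs E) alpha d delta1)
  (bridge_spider (lhs_valid E)).
have [R2 [A2 [c2 H2]]] := layered_automaton x y
  (@node_layer_leg _ _ _ _ (rhs E) alpha d delta1)
  (bridge_spider (rhs_valid E)).
have uSome (u : seq nat) : uniq u -> uniq (None :: map Some u).
  move=> uu; rewrite /= map_inj_uniq => [|? ? [] //].
  by rewrite uu andbT; elim: u {uu}.
rewrite /layers_amplitude H1 ?H2 ?uSome ?iota_uniq //.
apply: runs_eq => _ /subseqP [b _ ->]; rewrite -map_mask.
set u := mask b _ => su.
have us : subseq u (iota 0 (d delta1)) by exact: mask_subseq.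
have uu : uniq u := subseq_uniq us (iota_uniq _ _).
have u_lt : all (gtn (d delta1)) u.
  by apply/allP => k /(mem_subseq us); rewrite mem_iota.
rewrite -H1 ?uSome // -H2 ?uSome //.
(* A subword is the instance keeping only the copies in [u], where [delta1] is instantiated at
   [size u]. *)
have := amplitude_resize alpha (lhs_valid E) y x u_lt uu.
have := amplitude_resize alpha (rhs_valid E) y x u_lt uu.
rewrite /layers_amplitude => <- <-.
set y' := finfun _; set x' := finfun _.
have /matrixP/(_ (enum_rank y') (enum_rank x')) :
    holds E alpha (resize d delta1 u).
  apply: (sound_small (size u)); last by rewrite /resize eqxx.
  rewrite size_map in su; apply: leq_trans su _.
  (* Each automaton has 2 to the number of bridges as its dimension, at most the dimension of the
     join. *)
  rewrite !card_ffun !card_bool !card_ord.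
  rewrite leq_add // leq_exp2l //.
    exact: card_bridges (lhs_valid E) sepL.
  exact: card_bridges (rhs_valid E) sepR.
by rewrite !mxE !enum_rankK.
Qed.
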